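(* Let $\cong$ be a congruence on LTSs such that $L\doteq L'$ implies $L\cong L'$, $\cong$ preserves $\mathit{Tr}$ and $\mathit{Sf}$ but does not preserve $\mathit{Inf}$, and $D\cong B$. Then $\cong$ is the equivalence induced by $\Sigma$, $\mathit{Tr}$ and $\mathit{Sf}$.
   Context: An LTS is a tuple $L=(S,\Sigma,\Delta,\hat s)$ with states $S$, alphabet $\Sigma$ (possibly infinite), $\tau\notin\Sigma$ a reserved invisible action, transitions $\Delta\subseteq S\times(\Sigma\cup\{\tau\})\times S$, initial state $\hat s$; $\Sigma(L)$ denotes the alphabet. Operators: action prefix $a.L$ ($a\neq\tau$): new initial state $\hat s'$, alphabet $\Sigma\cup\{a\}$, transitions $\Delta\cup\{(\hat s',a,\hat s)\}$. Hiding $L\setminus A$: alphabet $\Sigma\setminus A$, each transition labelled by an element of $A$ relabelled $\tau$, otherwise unchanged. Relational renaming $L\Phi$ ($\Phi$ a set of pairs, $\tau$ not in its domain $\mathcal D(\Phi)$ or range; $\Phi(a,b)$ means $(a,b)\in\Phi$ or $a=b\notin\mathcal D(\Phi)$): alphabet $\{b\mid\exists a\in\Sigma:\Phi(a,b)\}$, transitions $\{(s,b,s')\mid\exists a:(s,a,s')\in\Delta\wedge\Phi(a,b)\}$, same states and initial state. Parallel composition $L_1\|L_2$: states $S_1\times S_2$, alphabet $\Sigma_1\cup\Sigma_2$, initial $(\hat s_1,\hat s_2)$; actions in $\Sigma_1\cap\Sigma_2$ are taken jointly by both components, all other actions (including $\tau$) by one component while the other stays put. A congruence is an equivalence $\cong$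 with $L\cong L'\Rightarrow a.L\cong a.L',\ L\setminus A\cong L'\setminus A,\ L\Phi\cong L'\Phi,\ L\|L''\cong L'\|L'',\ L''\|L\cong L''\|L'$. For $\sigma=a_1\cdots a_n\in\Sigma^*$, $s\stackrel{\sigma}{\Rightarrow}s'$ means a finite path from $s$ to $s'$ whose non-$\tau$ labels are exactly $a_1,\dots,a_n$ in order; $\hat s\stackrel{\xi}{\Rightarrow}$ for $\xi\in\Sigma^\omega$ means an infinite path from $\hat s$ whose non-$\tau$ label sequence is $\xi$; $s\stackrel{\tau^\omega}{\to}$ means an infinite path of $\tau$-transitions from $s$. Define $\mathit{Tr}(L)=\{\sigma\in\Sigma^*\mid\exists s:\hat s\stackrel\sigma\Rightarrow s\}$, $\mathit{Div}(L)=\{\sigma\in\Sigma^*\mid\exists s:\hat s\stackrel\sigma\Rightarrow s\wedge s\stackrel{\tau^\omega}\to\}$, $\mathit{Inf}(L)=\{\xi\in\Sigma^\omega\mid\hat s\stackrel\xi\Rightarrow\}$, $\mathit{Sf}(L)=\{(\sigma,A)\in\Sigma^*\times2^\Sigma\mid\exists s:\hat s\stackrel\sigma\Rightarrow s\wedge\forall a\in A\cup\{\tau\}\,\forall s':(s,a,s')\notin\Delta\}$. $L\doteq L'$ (CFFD-equivalence) iff $\Sigma,\mathit{Sf},\mathit{Div},\mathit{Inf}$ all agree on $L$ and $L'$. An equivalence preserves $X$ if $L\cong L'\Rightarrow X(L)=X(L')$; the equivalence induced by $\Sigma,X_1,\dots,X_k$ relates $L,L'$ iff all these functions agree on them. $D$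 is the one-state LTS with empty alphabet and no transitions; $B$ is the LTS with empty alphabet, states $s_0$ (initial) and $s_1$, and transitions $(s_0,\tau,s_0)$, $(s_0,\tau,s_1)$. *)

(* Defs.v *)
From mathcomp Require Import all_boot.
From mathcomp Require Import boolp classical_sets cardinality.

Set Implicit Arguments.
Unset Strict Implicit.
Unset Printing Implicit Defensive.

Local Open Scope classical_set_scope.

(* [Act] is the universe of visible actions; alphabets are arbitrary subsets
   of it.  The universe is meant to be infinite, so that fresh actions are
   available: with a single action, not enough operators remain to express
   internal choice.  A transition label is an [option Act], where [None] is the invisible
   action tau, so that tau belongs to no alphabet by construction. *)
Record LTS (Act : Type) := MkLTS {
  state : Type;
  alphabet : set Act;
  trans : state -> option Act -> state -> Prop;
  init : state;
  trans_alphabet : forall s a s', trans s (Some a) s' -> alphabet a }.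

Section Operators.
Variable Act : Type.
Implicit Types (L : LTS Act) (A : set Act) (Phi : set (Act * Act)).

(* [None] is the new initial state. *)
Definition prefix_trans (a : Act) L (s : option (state L)) (x : option Act)
    (t : option (state L)) : Prop :=
  match s, t with
  | None, Some t' => x = Some a /\ t' = init L
  | Some s', Some t' => trans s' x t'
  | _, None => False
  end.

Lemma prefix_trans_alphabet a L s b t :
  @prefix_trans a L s (Some b) t -> (alphabet L `|` [set a]) b.
Proof.
case: s t => [s|] [t|] //= => [h|[[->] _]]; last by right.
by left; exact: trans_alphabet h.
Qed.

Definition lts_prefix (a : Act) L : LTS Act :=
  {| state := option (state L);
     alphabet := alphabet L `|` [set a];
     trans := @prefix_trans a L;
     init := None;
     trans_alphabet := @prefix_trans_alphabet a L |}.

Definition hide_trans L A (s : state L) (x : option Act) (t : state L) : Prop :=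
  match x with
  | Some b => trans s (Some b) t /\ ~ A b
  | None => trans s None t \/ exists2 a, A a & trans s (Some a) t
  end.

Lemma hide_trans_alphabet L A s b t :
  @hide_trans L A s (Some b) t -> (alphabet L `\` A) b.
Proof. by case=> h nAb; split=> //; exact: trans_alphabet h. Qed.

Definition lts_hide L A : LTS Act :=
  {| state := state L;
     alphabet := alphabet L `\` A;
     trans := @hide_trans L A;
     init := init L;
     trans_alphabet := @hide_trans_alphabet L A |}.

Definition rename_dom Phi : set Act := [set a | exists b, Phi (a, b)].

Definition rename_rel Phi (a b : Act) : Prop :=
  Phi (a, b) \/ (a = b /\ ~ rename_dom Phi a).

(* tau is outside the domain and the range of Phi, hence it is only related to
   itself. *)
Definition rename_trans L Phi (s : state L) (x : option Act) (t : state L) :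
    Prop :=
  match x with
  | Some b => exists a, trans s (Some a) t /\ rename_rel Phi a b
  | None => trans s None t
  end.

Lemma rename_trans_alphabet L Phi s b t :
  @rename_trans L Phi s (Some b) t ->
  [set b | exists a, alphabet L a /\ rename_rel Phi a b] b.
Proof. by case=> a [h ab]; exists a; split=> //; exact: trans_alphabet h. Qed.

Definition lts_rename L Phi : LTS Act :=
  {| state := state L;
     alphabet := [set b | exists a, alphabet L a /\ rename_rel Phi a b];
     trans := @rename_trans L Phi;
     init := init L;
     trans_alphabet := @rename_trans_alphabet L Phi |}.

Definition shared L1 L2 (x : option Act) : Prop :=
  exists2 a, (alphabet L1 `&` alphabet L2) a & x = Some a.

Definition par_trans L1 L2 (s : state L1 * state L2) (x : option Act)
    (t : state L1 * state L2) : Prop :=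
  [\/ [/\ shared L1 L2 x, trans s.1 x t.1 & trans s.2 x t.2],
      [/\ ~ shared L1 L2 x, trans s.1 x t.1 & s.2 = t.2] |
      [/\ ~ shared L1 L2 x, s.1 = t.1 & trans s.2 x t.2]].

Lemma par_trans_alphabet L1 L2 s b t :
  @par_trans L1 L2 s (Some b) t -> (alphabet L1 `|` alphabet L2) b.
Proof.
case=> [[_ h _]|[_ h _]|[_ _ h]]; [left|left|right];
  exact: trans_alphabet h.
Qed.

Definition lts_par L1 L2 : LTS Act :=
  {| state := (state L1 * state L2)%type;
     alphabet := alphabet L1 `|` alphabet L2;
     trans := @par_trans L1 L2;
     init := (init L1, init L2);
     trans_alphabet := @par_trans_alphabet L1 L2 |}.

End Operators.

Section Semantics.
Variable Act : Type.
Implicit Types (L : LTS Act).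

Fixpoint path_from_to L (s : state L) (ls : seq (option Act)) (s' : state L) :
    Prop :=
  match ls with
  | [::] => s = s'
  | x :: ls' => exists2 t, trans s x t & path_from_to t ls' s'
  end.

(* [pmap id ls] erases the tau labels of [ls]. *)
Definition weak L (s : state L) (sigma : seq Act) (s' : state L) : Prop :=
  exists2 ls, path_from_to s ls s' & pmap id ls = sigma.

Definition infinite_path L (s : state L) (p : nat -> state L)
    (l : nat -> option Act) : Prop :=
  p 0 = s /\ forall n, trans (p n) (l n) (p n.+1).

(* [k] is the increasing enumeration of the positions of the non-tau labels. *)
Definition visible_sequence (l : nat -> option Act) (xi : nat -> Act) : Prop :=
  exists k : nat -> nat,
    [/\ {homo k : i j / (i < j)%N},
        forall i, l (k i) = Some (xi i) &
        forall n, l n <> None -> exists i, n = k i].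

Definition weak_inf L (s : state L) (xi : nat -> Act) : Prop :=
  exists p l, infinite_path s p l /\ visible_sequence l xi.

Definition diverges L (s : state L) : Prop :=
  exists p, infinite_path s p (fun=> None).

Definition Tr L : set (seq Act) :=
  [set sigma | exists s, weak (init L) sigma s].

Definition Div L : set (seq Act) :=
  [set sigma | exists s, weak (init L) sigma s /\ diverges s].

Definition Inf L : set (nat -> Act) := [set xi | weak_inf (init L) xi].

Definition Sf L : set (seq Act * set Act) :=
  [set f | f.2 `<=` alphabet L /\
    exists s, [/\ weak (init L) f.1 s,
                  forall s', ~ trans s None s' &
                  forall a, f.2 a -> forall s', ~ trans s (Some a) s']].

Definition cffd_equiv L L' : Prop :=
  [/\ alphabet L = alphabet L', Sf L = Sf L', Div L = Div L' & Inf L = Inf L'].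

End Semantics.

Section Congruences.
Variable Act : Type.
Implicit Types (R : LTS Act -> LTS Act -> Prop).

Record is_congruence R : Prop := IsCongruence {
  cong_refl : forall L, R L L;
  cong_sym : forall L L', R L L' -> R L' L;
  cong_trans : forall L1 L2 L3, R L1 L2 -> R L2 L3 -> R L1 L3;
  cong_prefix : forall a L L', R L L' -> R (lts_prefix a L) (lts_prefix a L');
  cong_hide : forall A L L', R L L' -> R (lts_hide L A) (lts_hide L' A);
  cong_rename : forall Phi L L',
    R L L' -> R (lts_rename L Phi) (lts_rename L' Phi);
  cong_parl : forall L'' L L', R L L' -> R (lts_par L L'') (lts_par L' L'');
  cong_parr : forall L'' L L', R L L' -> R (lts_par L'' L) (lts_par L'' L') }.

Definition preserves (T : Type) R (X : LTS Act -> T) : Prop :=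
  forall L L', R L L' -> X L = X L'.

Definition induced_by_alphabet_Tr_Sf (L L' : LTS Act) : Prop :=
  [/\ alphabet L = alphabet L', Tr L = Tr L' & Sf L = Sf L'].

Definition ltsD : LTS Act :=
  {| state := unit;
     alphabet := set0;
     trans := fun _ _ _ => False;
     init := tt;
     trans_alphabet := fun _ _ _ => False_ind _ |}.

(* [false] is s_0 and [true] is s_1. *)
Definition B_trans (s : bool) (x : option Act) (t : bool) : Prop :=
  s = false /\ x = None.

Lemma B_trans_alphabet s b t : B_trans s (Some b) t -> (set0 : set Act) b.
Proof. by case. Qed.

Definition ltsB : LTS Act :=
  {| state := bool;
     alphabet := set0;
     trans := B_trans;
     init := false;
     trans_alphabet := B_trans_alphabet |}.

End Congruences.

Arguments ltsD {Act}.
Arguments ltsB {Act}.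

(* Main.v *)
(** Composing with [B] makes every trace divergent, so [R] cannot see [Div];
    only [Inf] has to be eliminated.  As [R] does not preserve [Inf], some
    [R]-equivalent [M], [M'] disagree on an infinite word [xi].  Running them
    against a diverging process that can only perform [xi], and renaming every
    action to [a], gives [R]-equivalent [P], [Q] with alphabet [{a}], no stable
    state, such that [P] has the infinite word [a^omega] and [Q] has not.

    For every [L] there is a context [G_L] such that [G_L[X]] internally chooses
    between behaving as [L] and running [X], where each action of [X] permits
    one more action along a trace of [L].  Then [G_L[Q]] differs from [L] at
    most in [Div], while the infinite words of [G_L[P]] are all those with every
    finite prefix in [Tr L].  Hence [L], [G_L[Q]] and [G_L[P]] are equivalent,
    and [G_L[P]] depends, up to [Div], only on the alphabet, [Tr] and [Sf] of
    [L].  The context needs one action outside the alphabet of [L]; the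
    injection [f] below makes room for it. *)
Require Import Defs.
From mathcomp Require Import all_boot.
From mathcomp Require Import boolp classical_sets functions cardinality.

Set Implicit Arguments.
Unset Strict Implicit.
Unset Printing Implicit Defensive.

Local Open Scope classical_set_scope.

(** * Weak steps and infinite traces *)

Section WeakSteps.
Variables (Act : Type) (L : LTS Act).
Implicit Types (s t u : state L) (sigma rho : seq Act) (xi : nat -> Act).

Lemma weak_refl s : weak s [::] s.
Proof. by exists [::]. Qed.

Lemma weak_trans s t u sigma rho :
  weak s sigma t -> weak t rho u -> weak s (sigma ++ rho) u.
Proof.
move=> [ls Hls <-] [ls' Hls' <-]; exists (ls ++ ls'); last by rewrite pmap_cat.
by elim: ls s Hls => [|x ls IH] s /= => [->//|[v sv /IH]]; exists v.
Qed.

Lemma weak_tau s t : trans s None t -> weak s [::] t.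
Proof. by move=> st; exists [:: None] => //=; exists t. Qed.

Lemma weak_visible s b t : trans s (Some b) t -> weak s [:: b] t.
Proof. by move=> st; exists [:: Some b] => //=; exists t. Qed.

Lemma weak_rcons_tau s t u sigma :
  weak s sigma t -> trans t None u -> weak s sigma u.
Proof. by move=> st /weak_tau tu; rewrite -[sigma]cats0; exact: weak_trans tu. Qed.

Lemma weak_rcons_visible s t u sigma b :
  weak s sigma t -> trans t (Some b) u -> weak s (rcons sigma b) u.
Proof. by move=> st /weak_visible tu; rewrite -cats1; exact: weak_trans tu. Qed.

(** The induction principle behind most projections and embeddings of weak runs below: [I] relates a
    state to the visible word read so far, [rho] being what was read before the run starts. *)
Lemma weak_invariant (I : state L -> seq Act -> Prop) s t sigma rho :
  (forall u v r, I u r -> trans u None v -> I v r) ->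
  (forall u v r b, I u r -> trans u (Some b) v -> I v (rcons r b)) ->
  I s rho -> weak s sigma t -> I t (rho ++ sigma).
Proof.
move=> It Iv Is [ls Hls <-]; elim: ls s rho Is Hls => [|x ls IH] s rho Is /=.
  by move=> <-; rewrite cats0.
case=> v; case: x => [b|] /= sv /IH; last by apply; exact: It sv.
by rewrite -cat_rcons; apply; exact: Iv sv.
Qed.

Lemma weak_alphabet s t sigma b : weak s (rcons sigma b) t -> alphabet L b.
Proof.
move=> st.
have: forall r c, [::] ++ rcons sigma b = rcons r c -> alphabet L c.
  apply: (@weak_invariant (fun _ r => forall r' c, r = rcons r' c -> alphabet L c)
    s t _ [::] _ _ _ st) => [//|u v r c _ uv r' c'|[] //].
  by move=> /rcons_inj[_ <-]; exact: trans_alphabet uv.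
by move/(_ sigma b); apply.
Qed.

(** Stopping right at the visible transition, with no silent moves after it, pins down the shape of
    the target; [gated_visible_step] relies on this. *)
Definition visible_step s b t := exists2 u, weak s [::] u & trans u (Some b) t.

Lemma visible_step_weak s b t : visible_step s b t -> weak s [:: b] t.
Proof. by case=> u su /(weak_rcons_visible su). Qed.

Lemma weak_inf_visible_steps s xi : weak_inf s xi ->
  exists2 p : nat -> state L, p 0 = s &
    forall n, visible_step (p n) (xi n) (p n.+1).
Proof.
case=> p [l [[p0 pS] [k [kmono lk ksurj]]]].
have silent i d : (forall j, i <= j < i + d -> l j = None) ->
    weak (p i) [::] (p (i + d)).
  elim: d => [|d IH] Hl; first by rewrite addn0; exact: weak_refl.
  have: weak (p i) [::] (p (i + d)).
    by apply: IH => j /andP[ij jd]; apply: Hl; rewrite ij addnS ltnS ltnW.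
  move/weak_rcons_tau; apply; rewrite addnS; have := pS (i + d).
  by rewrite Hl // leq_addr addnS /=.
(* The path is cut right after each visible label, so that all labels from position [from n] up to,
   but excluding, [k n] are silent. *)
pose from n := if n is m.+1 then (k m).+1 else 0.
exists (fun n => p (from n)) => // n; exists (p (k n)); last first.
  by have := pS (k n); rewrite lk.
have le_from : from n <= k n by case: n => //= n; exact: kmono.
rewrite -(subnKC le_from); apply: silent => j; rewrite subnKC // => /andP[j1 j2].
apply: contrapT => /ksurj[i Ei]; rewrite Ei in j1 j2.
have i_lt_n : i < n.
  rewrite ltnNge leq_eqVlt; apply/negP => /orP[/eqP En|/kmono]; last first.
    by rewrite ltnNge (ltnW j2).
  by rewrite En ltnn in j2.
case: n i_lt_n j1 {le_from j2} => // n; rewrite ltnS leq_eqVlt /=.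
by case/orP=> [/eqP->|/kmono /ltnW ink] kk;
  [rewrite ltnn in kk|move: (leq_trans kk ink); rewrite ltnn].
Qed.

Lemma weak_steps_weak_inf xi (p : nat -> state L) :
  (forall n, weak (p n) [:: xi n] (p n.+1)) -> weak_inf (p 0) xi.
Proof.
move=> Hp.
(* A configuration [(n, s, ls)] is inside the [n]-th weak step, at [s], with the
   labels [ls] still to be read before [p n.+1]. *)
pose conf := (nat * state L * seq (option Act))%type.
pose good (c : conf) :=
  path_from_to c.1.2 c.2 (p c.1.1.+1) /\ pmap id c.2 = [:: xi c.1.1].
pose step (c d : conf) := good c -> good d /\
  trans c.1.2 (head None c.2) d.1.2 /\
  if head None c.2 is Some x then x = xi c.1.1 /\ d.1.1 = c.1.1.+1
  else d.1.1 = c.1.1 /\ size d.2 < size c.2.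
have [nxt nxtP] : {f & forall c, step c (f c)}.
  apply: choice => -[[n s] ls].
  have [G|nG] := pselect (good (n, s, ls)); last by exists (n, s, ls).
  case: G => /=; case: ls => [|[x|] ls] //= [t st tp].
    (* The silent tail left after the visible label is joined to the labels of the next weak step,
       so the new configuration again has one visible label ahead. *)
    case=> xE lsn; subst x; have t_p : weak t [::] (p n.+1) by exists ls.
    have [ls' tp' lsE] := weak_trans t_p (Hp n.+1).
    by exists (n.+1, t, ls') => _; split.
  by move=> lsn; exists (n, t, ls) => _; split.
have [ls0 Hls0 ls0E] := Hp 0.
pose c i := iter i nxt (0, p 0, ls0); pose l i := head None (c i).2.
have good_c i : good (c i).
  by elim: i => [//|i IH]; rewrite /c iterS; have [] := nxtP _ IH.
have stepP i := (nxtP _ (good_c i)).2.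
have lvis i x : l i = Some x -> x = xi (c i).1.1 /\ (c i.+1).1.1 = (c i).1.1.+1.
  by have [_] := stepP i; rewrite -/(l i) => + lx; rewrite lx.
have ltau i : l i = None ->
    (c i.+1).1.1 = (c i).1.1 /\ size (c i.+1).2 < size (c i).2.
  by have [_] := stepP i; rewrite -/(l i) => + lx; rewrite lx.
have c_mono : {homo (fun i => (c i).1.1) : i j / i <= j}.
  apply: homo_leq => [//|i|i]; first exact: leq_trans.
  by case E: (l i) => [x|]; [case: (lvis _ _ E) => _ ->|case: (ltau _ E) => ->].
have next_visible n i : (c i).1.1 = n ->
    exists2 j, (c j).1.1 = n & l j = Some (xi n).
  (* Induction on a bound for the number of labels left: silent moves decrease it, and a good
     configuration always has a label left. *)
  move: {-1}(size (c i).2) (leqnn (size (c i).2)) => m.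
  elim: m i => [|m IH] i sm cn.
    have [_] := good_c i; case: (c i).2 sm => //.
  case E: (l i) => [x|].
    by exists i => //; rewrite E; have [-> _] := lvis _ _ E; rewrite cn.
  have [cS sS] := ltau _ E; apply: (IH i.+1); last by rewrite cS.
  by rewrite -ltnS (leq_trans sS).
have [k kP] : {k & forall n, (c (k n)).1.1 = n /\ l (k n) = Some (xi n)}.
  apply: (choice (P := fun n i => (c i).1.1 = n /\ l i = Some (xi n))).
  elim=> [|n [j [jn lj]]].
    by have [j] := next_visible 0 0 erefl; exists j.
  have [_ cS] := lvis _ _ lj.
  by have [j' ? ?] := next_visible n.+1 j.+1 (etrans cS (congr1 _ jn)); exists j'.
exists (fun i => (c i).1.2), l; split.
  by split=> // i; have [] := stepP i.
exists k; split=> [i j ij|i|n ln].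
- rewrite ltnNge; apply/negP => /c_mono /=.
  by rewrite (kP i).1 (kP j).1 leqNgt ij.
- exact: (kP i).2.
(* A visible move raises the index for good, so two distinct positions cannot both be visible with
   the same index. *)
exists (c n).1.1; have [] := kP (c n).1.1; set m := k _ => cm lm.
case: (ltngtP n m) => // [/c_mono|/c_mono] /=.
- by case E: (l n) ln => [x|] // _; rewrite cm (lvis _ _ E).2 ltnn.
- by rewrite (lvis _ _ lm).2 cm ltnn.
Qed.
End WeakSteps.

Lemma InfP (Act : Type) (L : LTS Act) (xi : nat -> Act) :
  Inf L xi <-> exists2 p : nat -> state L, p 0 = init L &
    forall n, weak (p n) [:: xi n] (p n.+1).
Proof.
split=> [/weak_inf_visible_steps[p p0 Hp]|[p p0 Hp]].
  by exists p => // n; exact: visible_step_weak.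
by rewrite /Inf /= -p0; exact: weak_steps_weak_inf.
Qed.

(** * Eliminating divergences *)

Section ParallelSilent.
Variables (Act : Type) (L E : LTS Act).
Hypothesis E_silent : alphabet E = set0.
Local Notation LE := (lts_par L E).

Lemma par_silent_trans (c c' : state LE) x :
  trans c x c' <-> trans c.1 x c'.1 /\ c.2 = c'.2 \/ c.1 = c'.1 /\ trans c.2 x c'.2.
Proof.
have nsh : ~ shared L E x by case=> a []; rewrite E_silent.
split=> [[[]|[]|[]]//|[] []]; by [left|right|constructor 2|constructor 3].
Qed.

Lemma par_silent_weak1 (c c' : state LE) sigma :
  weak c sigma c' -> weak c.1 sigma c'.1.
Proof.
apply: (@weak_invariant _ LE (fun d r => weak c.1 r d.1) c c' sigma [::]).
- move=> u v r cu /par_silent_trans[[uv _]|[<- _]] //; exact: weak_rcons_tau cu uv.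
- move=> u v r b cu /par_silent_trans[[uv _]|[_ uv]].
    exact: weak_rcons_visible cu uv.
  by have := trans_alphabet uv; rewrite E_silent.
exact: weak_refl.
Qed.

Lemma par_silent_weak (s t : state L) (e : state E) sigma :
  weak s sigma t -> weak ((s, e) : state LE) sigma (t, e).
Proof.
apply: (@weak_invariant _ L (fun d r => weak ((s, e) : state LE) r (d, e)) s t sigma [::]).
- by move=> u v r cu uv; apply: weak_rcons_tau cu _; apply/par_silent_trans; left.
- by move=> u v r b cu uv; apply: weak_rcons_visible cu _; apply/par_silent_trans; left.
exact: weak_refl.
Qed.

Lemma par_silent_alphabet : alphabet LE = alphabet L.
Proof. by rewrite /= E_silent setU0. Qed.

Lemma par_silent_Inf : Inf LE = Inf L.
Proof.
apply/seteqP; split=> xi /InfP[p p0 Hp]; apply/InfP.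
  exists (fun n => (p n).1) => [|n]; first by rewrite p0.
  exact: par_silent_weak1.
exists (fun n => (p n, init E)) => [|n]; first by rewrite p0.
exact: par_silent_weak.
Qed.

(** [E] may retire silently to the stuck state [e], where it no longer disturbs the stability of the
    states of [L]. *)
Lemma par_silent_Sf (e : state E) : weak (init E) [::] e ->
  (forall x e', ~ trans e x e') -> Sf LE = Sf L.
Proof.
move=> ie e_stuck; apply/seteqP; split=> -[sigma A] /=;
  rewrite /Sf /= E_silent setU0 => - [sA [s [s_i sn sa]]]; split=> //.
  exists s.1; split; first exact: (par_silent_weak1 s_i).
    move=> s' ss'; apply: (sn (s', s.2)).
    by apply/par_silent_trans; left.
  move=> a Aa s' ss'; apply: (sa a Aa (s', s.2)).
  by apply/par_silent_trans; left.
exists (s, e); split.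
- rewrite -[sigma]cats0.
  apply: (@weak_trans _ LE _ (s, init E)); first exact: par_silent_weak.
  apply: (@weak_invariant _ E (fun d r => weak ((s, init E) : state LE) r (s, d))
    _ _ _ [::] _ _ _ ie).
  + move=> u v r cu uv; apply: weak_rcons_tau cu _.
    by apply/par_silent_trans; right.
  + by move=> u v r b _ uv; have := trans_alphabet uv; rewrite E_silent.
  exact: weak_refl.
- by move=> [s' e'] /par_silent_trans[[/sn]|[_ /e_stuck]].
by move=> a Aa [s' e'] /par_silent_trans[[/(sa a Aa)]|[_ /e_stuck]].
Qed.

End ParallelSilent.

Lemma cffd_par_D (Act : Type) (L : LTS Act) : cffd_equiv L (lts_par L ltsD).
Proof.
split; rewrite ?par_silent_alphabet ?par_silent_Inf //.
  by rewrite (@par_silent_Sf _ _ ltsD _ tt) => [|||x e' []] //; exact: (@weak_refl _ ltsD tt).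
apply/seteqP; split=> sigma [s [s_i [p [p0 Hp]]]].
  exists (s, tt); split; first exact: par_silent_weak.
  exists (fun n => (p n, tt)); split=> [|n]; first by rewrite p0.
  by apply/par_silent_trans => //; left; split=> //; exact: Hp.
exists s.1; split; first exact: par_silent_weak1 s_i.
exists (fun n => (p n).1); split=> [|n]; first by rewrite p0.
by have /par_silent_trans[//|[]|[]] := Hp n.
Qed.

(** As long as [B] stays in its initial state, its silent loop is available whatever [L] has
    done. *)
Lemma par_B_Div (Act : Type) (L : LTS Act) : Div (lts_par L ltsB) = Tr L.
Proof.
apply/seteqP; split=> [sigma [s [s_i _]]|sigma [s s_i]].
  by exists s.1; exact: par_silent_weak1 s_i.
exists (s, false); split; first exact: par_silent_weak.
exists (fun=> (s, false)); split=> // n.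
by apply/par_silent_trans => //; right.
Qed.

Definition loop_trans (Act : Type) (a : Act) (_ : unit) (x : option Act)
  (_ : unit) : Prop := x = Some a.

Lemma loop_trans_alphabet (Act : Type) (a : Act) s b t :
  loop_trans a s (Some b) t -> [set a] b.
Proof. by case. Qed.

Definition lts_loop (Act : Type) (a : Act) : LTS Act :=
  MkLTS tt (@loop_trans_alphabet Act a).

Section Congruence.
Variables (Act : Type) (R : LTS Act -> LTS Act -> Prop).
Hypotheses (R_congruence : is_congruence R)
  (cffd_R : forall L L' : LTS Act, cffd_equiv L L' -> R L L')
  (R_D_B : R ltsD ltsB).

(** [M] is CFFD-equivalent to [M || D], hence [R]-related to [M || B]. The latter keeps the
    alphabet, [Sf] and [Inf] of [M], but its [Div] is [Tr M]; so [L || B] and [L' || B] are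
    CFFD-equivalent. *)
Lemma R_Tr_Sf_Inf (L L' : LTS Act) : induced_by_alphabet_Tr_Sf L L' ->
  Inf L = Inf L' -> R L L'.
Proof.
have R_par_B M : R M (lts_par M ltsB).
  apply: (cong_trans R_congruence) (cffd_R (cffd_par_D M)) _.
  exact: cong_parr.
move=> [LA LT LS] LI; apply: (cong_trans R_congruence) (R_par_B L) _.
apply: (cong_sym R_congruence); apply: (cong_trans R_congruence) (R_par_B L') _.
have B_true : @weak Act ltsB false [::] true by exact: weak_tau.
have SfB (M : LTS Act) : Sf (lts_par M ltsB) = Sf M.
  by apply: (@par_silent_Sf _ M ltsB erefl true B_true) => x e' [].
by apply: cffd_R; split; rewrite ?par_silent_alphabet ?par_silent_Inf ?par_B_Div ?SfB.
Qed.

(* An [a]-loop in parallel with [L] is blocked initially if [a] is in the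
   alphabet of [L] but not in [Tr L], and runs freely if [a] is not in the
   alphabet of the other component. *)
Lemma R_alphabet (R_Tr : preserves R (@Tr Act)) (L L' : LTS Act) :
  R L L' -> alphabet L `<=` alphabet L'.
Proof.
move=> RLL' a La; apply: contrapT => nL'a.
pose M := lts_loop a.
have : Tr (lts_par L' M) [:: a].
  exists (init L', tt); apply: weak_visible; constructor 3.
  by split=> // -[b [L'b _] [ab]]; apply: nL'a; rewrite ab.
rewrite -(R_Tr _ _ (cong_parl R_congruence M RLL')) => -[[s []]] w.
have : weak (init L) ([::] ++ [:: a]) s.
  apply: (@weak_invariant _ (lts_par L M) (fun d r => weak (init L) r d.1)
      _ _ _ _ _ _ _ w).
  - move=> [u ?] [v ?] r Iu [[[]//]|[_ uv _]|[_ _ //]].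
    exact: weak_rcons_tau Iu uv.
  - move=> [u ?] [v ?] r b Iu [[_ uv _]|[_ uv _]|[nsh _ /= [ba]]].
    + exact: weak_rcons_visible Iu uv.
    + exact: weak_rcons_visible Iu uv.
    + by case: nsh; exists b => //; rewrite ba.
  exact: weak_refl.
move=> aL; have: Tr L [:: a] by exists s.
by rewrite (R_Tr _ _ RLL') => -[t aL']; exact: nL'a (@weak_alphabet _ _ _ _ [::] _ aL').
Qed.

End Congruence.

(** * The context selecting between a process and its limit closure *)

Section Gate.
Variables (Act : Type) (f : Act -> Act) (a : Act).
Hypotheses (f_inj : injective f) (f_neq_a : forall x, f x <> a).

(* [Copy] behaves as [L]; [Ready r] and [Pending r] generate the traces of [L],
   with one [a] before each further action. *)
Inductive gate_state (L : LTS Act) : Type :=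
  Start | Copy of state L | Ready of seq Act | Pending of seq Act.
Arguments Start {L}.
Arguments Copy {L}.
Arguments Ready {L}.
Arguments Pending {L}.

(** The actions of [L] are emitted through [f], whose range misses [a]; this keeps [a] free for
    synchronising with [P], and the renaming in [gated] undoes [f]. *)
Definition gate_trans L (g : gate_state L) (x : option Act) (g' : gate_state L) :
    Prop :=
  match g, g' with
  | Start, Copy s => x = None /\ s = init L
  | Start, Ready r => x = Some a /\ r = [::]
  | Copy s, Copy t => exists2 y, trans s y t & x = omap f y
  | Ready r, Pending r' =>
      exists b, [/\ x = Some (f b), r' = rcons r b & Tr L r']
  | Pending r, Ready r' => x = Some a /\ r' = r
  | _, _ => False
  end.

Lemma gate_trans_alphabet L s b t :
  @gate_trans L s (Some b) t -> (f @` alphabet L `|` [set a]) b.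
Proof.
case: s t => [|s|r|r] [|t|r'|r'] //=.
- by case.
- by case=> [[->]]; right.
- case=> -[c|] // sct [->]; left; exists c => //; exact: trans_alphabet sct.
- case=> c [[->] -> [t rct]]; left; exists c => //; exact: weak_alphabet rct.
- by case=> [[->]]; right.
Qed.

Definition gate L : LTS Act :=
  {| state := gate_state L;
     alphabet := f @` alphabet L `|` [set a];
     trans := @gate_trans L;
     init := Start;
     trans_alphabet := @gate_trans_alphabet L |}.

(* The first action of [a.P] commits the gate to generating traces, and every
   later one permits one visible action. *)
Definition gated L P : LTS Act :=
  lts_rename (lts_hide (lts_par (lts_prefix a P) (gate L)) [set a])
    [set x | x.1 = f x.2].

Variables (L P : LTS Act).
Hypotheses (P_alphabet : alphabet P = [set a])
  (P_tau : forall q : state P, trans q None q).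
Implicit Types (c : state (gated L P)).

Lemma gated_alphabet : alphabet (gated L P) = alphabet L.
Proof.
apply/seteqP; split=> b /=.
  case=> c [[[Pc|[[d Ld <-]|//]] nca] fb].
    by case: nca; case: Pc; rewrite ?P_alphabet.
  by case: fb => [/= /f_inj <-//|[_ []]]; exists d.
move=> Lb; exists (f b); split; last by left.
by split; [right; left; exists b|exact: f_neq_a].
Qed.

Lemma gated_tau c c' : trans c None c' <->
  [\/ @trans _ (lts_prefix a P) c.1 None c'.1 /\ c.2 = c'.2,
      c.1 = c'.1 /\ @trans _ (gate L) c.2 None c'.2 |
      @trans _ (lts_prefix a P) c.1 (Some a) c'.1 /\
      @trans _ (gate L) c.2 (Some a) c'.2].
Proof.
have sh : shared (lts_prefix a P) (gate L) (Some a).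
  by exists a => //; split; right.
have nsh : ~ shared (lts_prefix a P) (gate L) None by case.
split=> [[[[]|[]|[]]|[b ->] [[]|[]|[]]]|[[]|[]|[]]] //.
- by constructor 1.
- by constructor 2.
- by constructor 3.
- by left; constructor 2.
- by left; constructor 3.
- by right; exists a => //; constructor 1.
Qed.

Lemma gated_visible c c' b : trans c (Some b) c' <->
  c.1 = c'.1 /\ @trans _ (gate L) c.2 (Some (f b)) c'.2.
Proof.
have prefix_a x : alphabet (lts_prefix a P) x -> x = a.
  by rewrite /= P_alphabet => -[].
split.
  case=> x [[cc' nxa] xb]; case: cc' => -[].
  - by case=> y [/prefix_a ya _] [xy]; case: nxa; rewrite /= xy.
  - by move=> _ cc'; case: nxa; exact: prefix_a (trans_alphabet cc').
  - move=> _ -> cc'; split=> //.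
    case: (trans_alphabet cc') => [[d _ dx]|/nxa //].
    case: xb => [/= <- //|[_ []]]; by exists d.
case=> c1 c2; exists (f b); split; last by left.
split; last exact: f_neq_a.
constructor 3; split=> // -[x [/prefix_a -> _]] [fba]; exact: f_neq_a fba.
Qed.

Lemma gated_loop c : c.1 <> None -> trans c None c.
Proof.
case: c => -[q|] g // _; apply/gated_tau; constructor 1; split=> //.
exact: P_tau.
Qed.

(** The [a] of the prefix already permits the first visible action, so in a [Pending] state [P] has
    performed one [a] fewer than there are visible actions. *)
Definition gated_invariant c (r : seq Act) : Prop :=
  match c with
  | (None, Start) => r = [::]
  | (None, Copy s) => weak (init L) r s
  | (Some q, Ready r') =>
      [/\ r = r', Tr L r & weak (init P) (nseq (size r) a) q]
  | (Some q, Pending r') =>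
      [/\ r = r', r <> [::], Tr L r & weak (init P) (nseq (size r).-1 a) q]
  | _ => False
  end.

Lemma gated_invariantP c r :
  weak (init (gated L P)) r c -> gated_invariant c r.
Proof.
apply: (@weak_invariant _ (gated L P) gated_invariant _ _ _ [::]) => //.
- move=> [q g] [q' g'] {}r Iu /gated_tau[[/=]|[/=]|[/=]].
  + case: q q' Iu => [q|] [q'|] //= Iu qq' gg'.
      subst g'; case: g Iu => [|s|r'|r'] //=.
        by case=> -> Lr w; split=> //; exact: weak_rcons_tau w qq'.
      by case=> -> r0 Lr w; split=> //; exact: weak_rcons_tau w qq'.
    by case: qq'.
  + move=> qq'; subst q'; case: g g' Iu => [|s|r'|r'] [|s'|r''|r''] //=;
      case: q => [q|] //=.
    * by move=> -> [_ ->]; exact: weak_refl.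
    * by move=> _ [].
    * by move=> w [[y|] ss'] // _; exact: weak_rcons_tau w ss'.
    * by move=> _ [b []].
    * by move=> _ [].
  + case: g g' Iu => [|s|r'|r'] [|s'|r''|r''] //=; case: q q' => [q|] [q'|] //=.
    * by move=> _ _ [].
    * move=> -> [_ ->] [_ ->]; split=> //; last exact: weak_refl.
      by exists (init L); exact: weak_refl.
    * by move=> _ _ [[y|] _] //= [/esym /f_neq_a].
    * by move=> _ _ [b [[/esym /f_neq_a]]].
    * case=> -> r0 Lr w qq' [_ ->]; split=> //.
      case: r' r0 w {Lr} => //= b r' _ w; rewrite -[a :: _]/(nseq (size r').+1 a).
      by rewrite -addn1 nseqD cats1; exact: weak_rcons_visible w qq'.
- move=> [q g] [q' g'] {}r b Iu /gated_visible[/= qq']; subst q'.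
  case: g g' Iu => [|s|r'|r'] [|s'|r''|r''] //=; case: q => [q|] //=.
  + by move=> _ [].
  + by move=> _ [[/f_neq_a]].
  + by move=> w [[y|] ss'] // [/f_inj by_]; rewrite by_; exact: weak_rcons_visible w ss'.
  + case=> -> Lr w [d [[/f_inj <-] -> Lrb]]; split=> //; first by case: (r').
    by rewrite size_rcons.
  + by move=> _ [[/f_neq_a]].
Qed.

Lemma gated_copy_weak s t r :
  weak s r t -> @weak _ (gated L P) (None, Copy s) r (None, Copy t).
Proof.
apply: (@weak_invariant _ L
  (fun t r => @weak _ (gated L P) (None, Copy s) r (None, Copy t)) s t r [::]).
- move=> u v r' w uv; apply: weak_rcons_tau w _; apply/gated_tau.
  by constructor 2; split=> //; exists None.
- move=> u v r' b w uv; apply: weak_rcons_visible w _; apply/gated_visible.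
  by split=> //; exists (Some b).
exact: weak_refl.
Qed.

Lemma gated_start_copy r s : weak (init L) r s ->
  weak (init (gated L P)) r (None, Copy s).
Proof.
move=> w; apply: (@weak_trans _ _ _ _ _ [::]) (gated_copy_weak w).
by apply: weak_tau; apply/gated_tau; constructor 2.
Qed.

Lemma gated_Tr : Tr (gated L P) = Tr L.
Proof.
apply/seteqP; split=> r; last first.
  by case=> s /gated_start_copy w; exists (None, Copy s).
case=> -[[q|] [|s|r'|r']] /gated_invariantP //=.
- by case.
- by case.
- by move=> ->; exists (init L); exact: weak_refl.
- by exists s.
Qed.

(** Once [P] is started, its silent loops exclude stability, and [Start] can silently move to a
    copy. Stable states thus come from [Copy] alone. *)
Lemma gated_Sf : Sf (gated L P) = Sf L.
Proof.
apply/seteqP; split=> -[r A]; rewrite /Sf /mkset gated_alphabet => - [AL];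
    split=> //.
  case: b => -[[q|] g] [w nt nv].
    by have := nt (Some q, g); case; exact: gated_loop.
  case: g w nt nv => [|s|r'|r'] w nt nv.
  - by case: (nt (None, Copy (init L))); apply/gated_tau; constructor 2.
  - exists s; split; first exact: gated_invariantP w.
      move=> s' ss'; apply: (nt (None, Copy s')); apply/gated_tau.
      by constructor 2; split=> //; exists None.
    move=> b Ab s' ss'; apply: (nv b Ab (None, Copy s')); apply/gated_visible.
    by split=> //; exists (Some b).
  - by case: (gated_invariantP w).
  - by case: (gated_invariantP w).
case: b => s [w nt nv]; exists (None, Copy s); split.
- exact: gated_start_copy.
- move=> [[q|] [|s'|r'|r']] /gated_tau[[]|[]|[]] //=.
  + by case.
  + by move=> _ [[y|] _] //= [/esym /f_neq_a].
  + by move=> _ [[y|] // /nt].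
- move=> b Ab [[q|] [|s'|r'|r']] /gated_visible[] //= _.
  by case=> -[y|] // ss' [/f_inj by_]; apply: (nv b Ab s'); rewrite by_.
Qed.

Definition gated_running (q : state P) c (r : seq Act) : Prop :=
  match c with
  | (Some q', Pending _) => weak q (nseq (size r) a) q'
  | (Some q', Ready _) => weak q (nseq (size r).+1 a) q'
  | _ => False
  end.

Lemma gated_runningP q r rho c :
  weak ((Some q, Pending r) : state (gated L P)) rho c -> gated_running q c rho.
Proof.
apply: (@weak_invariant _ (gated L P) (gated_running q) _ _ _ [::]).
- move=> [[q1|] g] [q2 g'] r' //= Iu /gated_tau[[/=]|[/=]|[/=]].
  + case: q2 => [q2|] //= q12 gg'; subst g'; case: g Iu => //= r'' w'.
      exact: weak_rcons_tau w' q12.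
    exact: weak_rcons_tau w' q12.
  + by move=> _; case: g g' Iu => [|s|s|s] [|s'|s'|s'] //= _ [] // ? [].
  + case: q2 => [q2|] //= q12; case: g g' Iu => [|s|s|s] [|s'|s'|s'] //= w'.
      by case=> d [[/esym /f_neq_a]].
    by move=> _; rewrite -[a :: _]/(nseq (size r').+1 a) -addn1 nseqD cats1;
      exact: weak_rcons_visible w' q12.
- move=> [[q1|] g] [q2 g'] r' d //= Iu /gated_visible[/= <-].
  case: g g' Iu => [|s|s|s] [|s'|s'|s'] //=; rewrite size_rcons //.
  by move=> _ [[/f_neq_a]].
exact: weak_refl.
Qed.

Lemma gated_visible_step c b c' : visible_step c b c' ->
  (exists s, c'.2 = Copy s) \/ (exists r, c'.2 = Pending r).
Proof.
case=> u _ /gated_visible[_].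
case: u.2 c'.2 => [|s|r|r] [|s'|r'|r'] //=.
- by left; exists s'.
- by case=> [[/f_neq_a]].
- by left; exists s'.
- by right; exists r'.
- by case=> [[/f_neq_a]].
Qed.

Lemma gated_copy_closed s r c :
  weak ((None, Copy s) : state (gated L P)) r c ->
  exists2 t, c = (None, Copy t) & weak s r t.
Proof.
apply: (@weak_invariant _ (gated L P)
  (fun c r => exists2 t, c = (None, Copy t) & weak s r t) _ _ _ [::]).
- move=> _ [[q|] [|s'|r'|r']] r'' [t -> w] /gated_tau[[]|[]|[]] //=.
  + by case.
  + by move=> _ [[y|] _] //= [/esym /f_neq_a].
  + by move=> _ [[y|] // ts' _]; exists s' => //; exact: weak_rcons_tau w ts'.
- move=> _ [[q|] [|s'|r'|r']] r'' b [t -> w] /gated_visible[] //= _.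
  by case=> -[y|] // ts' [/f_inj ->]; exists s' => //; exact: weak_rcons_visible w ts'.
by exists s => //; exact: weak_refl.
Qed.

Lemma gated_wait q q' r rho : weak q rho q' -> rho = [:: a] ->
  @weak _ (gated L P) (Some q, Pending r) [::] (Some q', Ready r).
Proof.
(* The invariant follows words of length at most one: the gate is [Pending] before the [a] of [P]
   and [Ready] after it. *)
pose I q' (rho : seq Act) :=
  (rho = [::] -> @weak _ (gated L P) (Some q, Pending r) [::] (Some q', Pending r)) /\
  (rho = [:: a] -> @weak _ (gated L P) (Some q, Pending r) [::] (Some q', Ready r)).
move=> w; suff [_] : I q' rho by [].
apply: (@weak_invariant _ P I _ _ _ [::] _ _ _ w).
- move=> u v r' [I1 I2] uv; split=> [/I1|/I2] w'; apply: weak_rcons_tau w' _;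
    by apply/gated_tau; constructor 1.
- move=> u v r' b [I1 _] uv; split; first by case: (r').
  have := trans_alphabet uv; rewrite P_alphabet => ba.
  case: r' I1 => [|? [|? ?]] // /(_ erefl) w' _; apply: weak_rcons_tau w' _.
  by apply/gated_tau; constructor 3; split=> //=; rewrite -ba.
by split=> // _; exact: weak_refl.
Qed.

Lemma gated_Inf : Inf (gated L P) = Inf L `|`
  [set xi | Inf P (fun=> a) /\ forall n, Tr L (mkseq xi n)].
Proof.
apply/seteqP; split=> xi; last first.
  case=> [/InfP[p p0 Hp]|[/InfP[p p0 Hp] Lxi]]; apply/InfP.
    exists (fun n => if n is _.+1 then (None, Copy (p n)) else (None, Start)) => // n.
    case: n => [|n]; last exact: gated_copy_weak.
    by apply: gated_start_copy; rewrite -p0.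
  (* After [m + 1] visible actions [P] has performed only [m] actions [a], since the prefix
     permitted the first one. *)
  exists (fun n => if n is m.+1 then (Some (p m), Pending (mkseq xi n)) else
    (None, Start)) => // n.
  have mkseqS m : mkseq xi m.+1 = rcons (mkseq xi m) (xi m).
    by rewrite /mkseq -addn1 iotaD map_cat cats1.
  apply: (@weak_rcons_visible _ (gated L P) _
    (Some (if n is m.+1 then p m.+1 else init P), Ready (mkseq xi n)) _ [::]).
    case: n => [|n]; last exact: gated_wait (Hp n) erefl.
    by apply: weak_tau; apply/gated_tau; constructor 3.
  apply/gated_visible; split; first by case: n => [|n] //=; rewrite p0.
  by exists (xi n); rewrite mkseqS -mkseqS.
move=> /weak_inf_visible_steps[p p0 Hp].
have Hpw n := visible_step_weak (Hp n).
have pre n : weak (init (gated L P)) (mkseq xi n) (p n).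
  elim: n => [|n IH]; first by rewrite p0; exact: weak_refl.
  rewrite /mkseq -addn1 iotaD map_cat addn1; exact: weak_trans IH (Hpw n).
(* The first visible action settles the branch: [Copy] is never left, and [Pending] never leads to
   [Copy]. *)
case: (gated_visible_step (Hp 0)) => [[s0 p1]|p1].
  left; apply/InfP.
  have copyP n : exists s, p n.+1 = (None, Copy s).
    elim: n => [|n [s ps]].
      have := gated_invariantP (pre 1); case: (p 1) p1 => -[q|] g /= -> //.
      by move=> _; exists s0.
    by have := Hpw n.+1; rewrite ps => /gated_copy_closed[t ->]; exists t.
  have [s sP] := choice copyP.
  exists (fun n => if n is m.+1 then s m else init L) => // -[|n].
    have := pre 1; rewrite sP => /gated_invariantP; exact.
  by have := Hpw n.+1; rewrite sP => /gated_copy_closed[t]; rewrite sP => -[->].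
right; split; last first.
  by move=> n; rewrite -gated_Tr; exists (p n).
have pendP n : exists q r, p n.+1 = (Some q, Pending r).
  elim: n => [|n [q [r pq]]].
    have := gated_invariantP (pre 1).
    by case: p1 => r; case: (p 1) => -[q|] g /= -> // _; exists q, r.
  have := Hpw n.+1; rewrite pq => /gated_runningP.
  case: (gated_visible_step (Hp n.+1)) => -[x].
    by case: (p n.+2) => -[q'|] g /= ->.
  by case: (p n.+2) => -[q'|] g /= -> //; exists q', x.
have [q qP] := choice pendP; apply/InfP.
(* [q 0] is reached from [init P] by silent moves only, so these are absorbed into the first
   step. *)
exists (fun n => if n is m.+1 then q m.+1 else init P) => // n.
have [r pn] := qP n; have [r' pSn] := qP n.+1.
have := Hpw n.+1; rewrite pn pSn => /gated_runningP.
case: n pn pSn => [|n] pn pSn //= w.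
have := gated_invariantP (pre 1); rewrite pn /= => -[_ _ _].
by move=> w0; exact: weak_trans w0 w.
Qed.

End Gate.

(** * Reducing an infinite word to a single action *)

Section Tracker.
Variables (Act : Type) (a : Act) (xi : nat -> Act).

(** The silent loops provide the unstable states that [gated_Sf] requires; the full alphabet of
    [tracker] forces every visible action of [L] to be shared, hence to be the next letter of
    [xi]. *)
Definition tracker_trans (m : nat) (x : option Act) (m' : nat) : Prop :=
  x = None /\ m' = m \/ x = Some (xi m) /\ m' = m.+1.

Lemma tracker_trans_alphabet m b m' :
  tracker_trans m (Some b) m' -> [set: Act] b.
Proof. by []. Qed.

Definition tracker : LTS Act := MkLTS 0 tracker_trans_alphabet.

(* What remains of [L] is whether it can perform [xi], encoded over the single
   action [a]. *)
Definition tracked L : LTS Act :=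
  lts_rename (lts_par L tracker) [set x | x.2 = a].

Variable L : LTS Act.

Lemma tracked_alphabet : alphabet (tracked L) = [set a].
Proof.
apply/seteqP; split=> b /=.
  by case=> c [_ [//|[_ []]]]; exists a.
by move=> ->; exists a; split; [right|left].
Qed.

Hypothesis xi_alphabet : forall n, alphabet L (xi n).
Implicit Types (c : state (tracked L)).

Lemma tracked_tau c c' : trans c None c' <->
  (trans c.1 None c'.1 \/ c.1 = c'.1) /\ c.2 = c'.2.
Proof.
have nsh : ~ shared L tracker None by case.
split=> [[[]|[_ cc' ->]|[_ -> [[_ ->]|[]]]]|[[cc'|cc'] c2]] //.
- by split=> //; left.
- by split=> //; right.
- by constructor 2.
- by constructor 3; split=> //; left.
Qed.

Lemma tracked_visible c b c' : trans c (Some b) c' <->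
  [/\ b = a, trans c.1 (Some (xi c.2)) c'.1 & c'.2 = c.2.+1].
Proof.
have sh n : shared L tracker (Some (xi n)) by exists (xi n).
split; last first.
  by case=> -> cc' c2; exists (xi c.2); split; [constructor 1; split=> //; right|left].
case=> x [cc' xb]; have -> : b = a by case: xb => [//|[_ []]]; exists a.
case: cc' => [[_ cc' [[]|[[<-] ?]]]|[nsh Lx _]|[nsh _ [[]|[xE]]]] //.
- by case: nsh; exists x => //; split=> //; exact: trans_alphabet Lx.
- by case: nsh; rewrite xE.
Qed.

Lemma tracked_tau_loop c : trans c None c.
Proof. by apply/tracked_tau; split=> //; right. Qed.

Lemma tracked_weak c c' r : weak c r c' ->
  c'.2 = c.2 + size r /\ weak c.1 (mkseq (fun i => xi (c.2 + i)) (size r)) c'.1.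
Proof.
apply: (@weak_invariant _ (tracked L) (fun c' r => c'.2 = c.2 + size r /\
  weak c.1 (mkseq (fun i => xi (c.2 + i)) (size r)) c'.1) _ _ _ [::]).
- move=> u v r' [u2 w] /tracked_tau[uv <-]; split=> //.
  by case: uv => [|<- //]; exact: weak_rcons_tau w.
- move=> u v r' b [u2 w] /tracked_visible[_ uv ->].
  rewrite u2 size_rcons addnS; split=> //.
  rewrite /mkseq -addn1 iotaD map_cat cats1 /= -u2.
  exact: weak_rcons_visible w uv.
by rewrite addn0; split=> //; exact: weak_refl.
Qed.

Lemma weak_tracked n s t r : weak s r t -> r = [:: xi n] ->
  @weak _ (tracked L) (s, n) [:: a] (t, n.+1).
Proof.
pose I t r := (r = [::] -> @weak _ (tracked L) (s, n) [::] (t, n)) /\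
  (r = [:: xi n] -> @weak _ (tracked L) (s, n) [:: a] (t, n.+1)).
move=> w; suff [_] : I t r by [].
apply: (@weak_invariant _ L I _ _ _ [::] _ _ _ w).
- move=> u v r' [I1 I2] uv; split=> [/I1|/I2] w'; apply: weak_rcons_tau w' _;
    by apply/tracked_tau; split=> //; left.
- move=> u v r' b [I1 _] uv; split; first by case: (r').
  case: r' I1 => [|? [|? ?]] // /(_ erefl) w' [bE]; rewrite bE in uv.
  apply: (weak_rcons_visible w'); exact/tracked_visible.
by split=> // _; exact: weak_refl.
Qed.

(** The tracker's state counts the visible steps, so the [n]-th [a] (from 0) can only stem from
    [xi n]. *)
Lemma tracked_Inf : Inf (tracked L) (fun=> a) <-> Inf L xi.
Proof.
split=> /InfP[p p0 Hp]; apply/InfP.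
  have p2 n : (p n).2 = n.
    elim: n => [|n IH]; first by rewrite p0.
    by rewrite (tracked_weak (Hp n)).1 IH addn1.
  exists (fun n => (p n).1) => [|n]; first by rewrite p0.
  by have := (tracked_weak (Hp n)).2; rewrite /mkseq /= p2 addn0.
exists (fun n => (p n, n)) => [|n]; first by rewrite p0.
exact: weak_tracked (Hp n) erefl.
Qed.

End Tracker.

(** * A fresh action, and the characterisation of the congruence *)

Lemma infinite_injection_avoiding (T : Type) : infinite_set [set: T] ->
  exists (f : T -> T) (a : T), injective f /\ forall x, f x <> a.
Proof.
move=> /infiniteP.
elim/Ppointed: T => T.
  by rewrite emptyE => /eqP nat0; have : [set: nat] 0 by []; rewrite nat0.
move=> /pcard_leP[g]; have g_inj i j : g i = g j -> i = j.
  by move/inj; rewrite !inE; apply.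
(* [f] shifts the copy of the naturals given by [g] by one and fixes everything else, which vacates
   [g 0]. *)
pose f x := if pselect (exists n, x = g n) is left h then g (projT1 (cid h)).+1
  else x.
have fg n : f (g n) = g n.+1.
  rewrite /f; case: pselect => [h|[]]; last by exists n.
  by congr (g _.+1); apply: g_inj; rewrite -(projT2 (cid h)).
have fN x : ~ (exists n, x = g n) -> f x = x by rewrite /f; case: pselect.
exists f, (g 0); split=> [x y|x].
  have [[n ->]|nx] := pselect (exists n, x = g n);
    have [[m ->]|ny] := pselect (exists n, y = g n).
  - by rewrite !fg => /g_inj[->].
  - by rewrite fg (fN y ny) => E; case: ny; exists n.+1.
  - by rewrite fg (fN x nx) => E; case: nx; exists m.+1.
  - by rewrite !fN.
have [[n ->]|nx] := pselect (exists n, x = g n).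
  by rewrite fg => /g_inj.
by rewrite fN // => xE; apply: nx; exists 0.
Qed.

Theorem theorem5p3 (Act : Type) (Act_infinite : infinite_set [set: Act])
    (R : LTS Act -> LTS Act -> Prop)
    (R_congruence : is_congruence R)
    (cffd_R : forall L L' : LTS Act, cffd_equiv L L' -> R L L')
    (R_Tr : preserves R (@Tr Act))
    (R_Sf : preserves R (@Sf Act))
    (R_not_Inf : ~ preserves R (@Inf Act))
    (R_D_B : R ltsD ltsB) :
  forall L L' : LTS Act, R L L' <-> induced_by_alphabet_Tr_Sf L L'.
Proof.
have Rsym := cong_sym R_congruence; have Rtrans := cong_trans R_congruence.
have R_alph M M' : R M M' -> alphabet M = alphabet M'.
  move=> RMM'; apply/seteqP; split; first exact: R_alphabet RMM'.
  by apply: R_alphabet (Rsym _ _ RMM').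
move=> L L'; split=> [RLL'|ind].
  by split; [exact: R_alph|exact: R_Tr|exact: R_Sf].
have [M [M' [xi [RMM' Mxi nM'xi]]]] :
    exists M M' xi, [/\ R M M', Inf M xi & ~ Inf M' xi].
  apply: contrapT => nex; apply: R_not_Inf => M M' RMM'.
  by apply/seteqP; split=> xi xiM; apply: contrapT => nxi; apply: nex;
    [exists M, M', xi|exists M', M, xi; split=> //; exact: Rsym].
have xiM n : alphabet M (xi n).
  by have /InfP[p _ /(_ n)] := Mxi; exact: (@weak_alphabet _ _ _ _ [::]).
have xiM' n : alphabet M' (xi n) by rewrite -(R_alph _ _ RMM').
have [f [a [f_inj f_neq_a]]] := infinite_injection_avoiding Act_infinite.
pose P := tracked a xi M; pose Q := tracked a xi M'.
have RPQ : R P Q by apply: cong_rename => //; exact: cong_parl.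
have P_a : Inf P (fun=> a) by apply/tracked_Inf.
have Q_a : ~ Inf Q (fun=> a) by move=> /(tracked_Inf a xiM').
have P_alph : alphabet P = [set a] by exact: tracked_alphabet.
have Q_alph : alphabet Q = [set a] by exact: tracked_alphabet.
have P_tau (q : state P) : trans q None q by exact: tracked_tau_loop.
have Q_tau (q : state Q) : trans q None q by exact: tracked_tau_loop.
have R_gated K : R K (gated f a K P).
  (* [Q] has no run with infinitely many [a], so by [gated_Inf] the context filled with [Q] has the
     same infinite words as [K]; congruence then exchanges [Q] for [P]. *)
  apply: (Rtrans _ (gated f a K Q)); last first.
    apply: Rsym; apply: cong_rename => //; apply: cong_hide => //.
    by apply: cong_parl => //; exact: cong_prefix.
  apply: R_Tr_Sf_Inf => //.
    by split; rewrite ?gated_alphabet ?gated_Tr ?gated_Sf.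
  rewrite gated_Inf //; apply/seteqP; split=> x; first by left.
  by case=> // -[].
apply: (Rtrans _ _ _ (R_gated L)); apply: Rsym; apply: (Rtrans _ _ _ (R_gated L')).
have [EA ET ES] := ind.
apply: R_Tr_Sf_Inf => //; first by split; rewrite ?gated_alphabet ?gated_Tr ?gated_Sf.
(* Finite prefixes of words in [Inf K] are traces of [K], so the limit closure of [Tr K] absorbs
   [Inf K]. *)
have Inf_gated K : Inf (gated f a K P) = [set x | forall n, Tr K (mkseq x n)].
  rewrite gated_Inf //; apply/seteqP; split=> x; last by right.
  case=> [/InfP[p p0 Hp] n|[]//]; exists (p n); rewrite -p0.
  elim: n => [|n IH]; first exact: weak_refl.
  rewrite /mkseq -addn1 iotaD map_cat addn1; exact: weak_trans IH (Hp n).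
by rewrite !Inf_gated ET.
Qed.
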